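(* Let $F$ be the graph on $5$ vertices consisting of an isolated vertex and two triangles sharing one edge. Let $G$ be a finite simple graph which satisfies condition $N_{2,2}$ and does not contain $F$ as an induced subgraph. Then $\mathrm{reg}(G)\leq 3$.
   Context: All graphs are finite and simple. Fix a field $k$ of characteristic $0$. For a graph $G$ with vertex set $[n]$, the non-edge ideal is $I(G)=\langle x_ix_j : i\neq j,\ ij\notin E(G)\rangle\subseteq k[x_1,\dots,x_n]$, and $\mathrm{reg}(G):=\max\{r : \beta_{i,i+r}(I(G))\neq 0 \text{ for some } i\}$ is its Castelnuovo-Mumford regularity, where $\beta_{i,j}$ are the graded Betti numbers. If $G$ is complete (so $I(G)=0$), $\mathrm{reg}(G)=1$ by convention. $G$ satisfies condition $N_{2,p}$ if $I(G)$ is generated by quadrics and the first $p-1$ steps of its minimal free resolution are linear, i.e. $\beta_{i,j}(I(G))=0$ for all $0\le i\leq p-1$ and $j\neq i+2$. It is known (Eisenbud-Green-Hulek-Popescu) that for $p\geq 2$ this is equivalent to $G$ containing no hole (induced cycle of length at least four) of length at most $p+2$; in particular $N_{2,2}$ means that $G$ has no induced $4$-cycle. *)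

(* Defs.v *)
From Stdlib Require Import ClassicalEpsilon.
From HB Require Import structures.
From mathcomp Require Import all_boot all_order all_algebra.
From mathcomp Require Import mpoly.

Set Implicit Arguments.
Unset Strict Implicit.
Unset Printing Implicit Defensive.

Import GRing.Theory.
Local Open Scope ring_scope.

Record graph (n : nat) := Graph {
  adj :> rel 'I_n;
  adj_sym : ssrbool.symmetric adj;
  adj_irr : irreflexive adj
}.

Definition complete (n : nat) (G : graph n) : bool :=
  [forall i, forall j, (i != j) ==> G i j].

Definition induced_subgraph (m n : nat) (H : graph m) (G : graph n) : Prop :=
  exists2 f : 'I_m -> 'I_n, injective f & forall x y, G (f x) (f y) = H x y.

(* Vertex 0 is isolated; the triangles 123 and 234 share the edge 23. *)
Definition F_edges : seq (nat * nat) :=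
  [:: (1, 2); (1, 3); (2, 3); (2, 4); (3, 4)]%N.

Definition F_adj : rel 'I_5 := fun x y =>
  ((val x, val y) \in F_edges) || ((val y, val x) \in F_edges).

Lemma F_adj_sym : ssrbool.symmetric F_adj.
Proof. by move=> x y; rewrite /F_adj orbC. Qed.

Lemma F_adj_irr : irreflexive F_adj.
Proof. by case; do 5?[case=> //]. Qed.

Definition F_graph : graph 5 := Graph F_adj_sym F_adj_irr.

Definition nonedge_ideal (k : fieldType) (n : nat) (G : graph n)
    (p : {mpoly k[n]}) : Prop :=
  exists c : 'I_n -> 'I_n -> {mpoly k[n]},
    p = \sum_i \sum_(j | (i != j) && ~~ G i j) c i j * ('X_i * 'X_j).

(* Graded modules and maps are given in coordinates: F_i is the module of row
   vectors of length [rank i], its a-th basis vector having degree [shift a],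
   and matrices act on the right:
     ... -> F_2 --(diff 1)--> F_1 --(diff 0)--> F_0 --(aug)--> k[x_1,...,x_n].
   Natural-number shifts suffice: the minimal resolution of an ideal has no
   basis vector of negative degree. *)
Record free_complex (k : fieldType) (n : nat) := FreeComplex {
  rank : nat -> nat;
  shift : forall i, 'I_(rank i) -> nat;
  aug : 'cV[{mpoly k[n]}]_(rank 0);
  diff : forall i, 'M[{mpoly k[n]}]_(rank i.+1, rank i)
}.

Record minimal_graded_free_resolution (k : fieldType) (n : nat)
    (I : {mpoly k[n]} -> Prop) (C : free_complex k n) : Prop := {
  aug_homog : forall a, aug C a 0 \is (shift a).-homog;
  diff_homog : forall i a b,
    if (shift b <= shift a)%N
    then diff C i a b \is (shift a - shift b).-homog
    else diff C i a b == 0;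
  aug_image : forall p,
    I p <-> exists v : 'rV_(rank C 0), v *m aug C = p%:M;
  aug_exact : forall v : 'rV_(rank C 0),
    v *m aug C = 0 <-> exists w : 'rV_(rank C 1), w *m diff C 0 = v;
  diff_exact : forall i (v : 'rV_(rank C i.+1)),
    v *m diff C i = 0 <-> exists w : 'rV_(rank C i.+2), w *m diff C i.+1 = v;
  (* every differential is zero modulo the ideal (x_1, ..., x_n) *)
  diff_minimal : forall i a b, (diff C i a b)@_0%MM = 0
}.

(* [Some] of a minimal resolution of I: one exists for every homogeneous ideal
   I, and its ranks and shifts do not depend on the choice, up to order. *)
Definition minimal_resolution (k : fieldType) (n : nat)
    (I : {mpoly k[n]} -> Prop) : option (free_complex k n) :=
  match excluded_middle_informative
          (exists C, minimal_graded_free_resolution I C) with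
  | left e => Some (proj1_sig (constructive_indefinite_description _ e))
  | right _ => None
  end.

Definition betti (k : fieldType) (n : nat) (I : {mpoly k[n]} -> Prop)
    (i j : nat) : nat :=
  if minimal_resolution I is Some C
  then #|[set a : 'I_(rank C i) | shift a == j]| else 0%N.

Definition N2 (k : fieldType) (n : nat) (G : graph n) (p : nat) : Prop :=
  forall i j : nat, (i < p)%N -> j <> (i + 2)%N ->
    betti (@nonedge_ideal k n G) i j = 0%N.

Definition is_max (P : nat -> Prop) (r : nat) : Prop :=
  P r /\ forall s, P s -> (s <= r)%N.

(* The last branch is never reached: if G is not complete then I(G) is nonzero
   and has finitely many nonzero Betti numbers. *)
Definition reg (k : fieldType) (n : nat) (G : graph n) : nat :=
  if complete G then 1%N else
  match excluded_middle_informative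
          (exists r, is_max (fun s => exists i,
             betti (@nonedge_ideal k n G) i (i + s)%N <> 0%N) r) with
  | left e => proj1_sig (constructive_indefinite_description _ e)
  | right _ => 0%N
  end.

(* Main.v *)
(* Hochster's formula in elementary form: the multidegree m strand of the Koszul
   complex of I(G) computes the reduced cohomology of the clique complex of G on
   the support of m when m is squarefree, and is a cone otherwise.  So
   reg(G) <= 3 follows once the clique complex of every induced subgraph has no
   reduced cohomology in degrees >= 2.

   Let x be a vertex that is not adjacent to some y.  Since G has no induced
   4-cycle, K = N(x) :&: N(y) is a clique; since G is F-free, N(x) \ K has no
   induced path on three vertices (it would form with x a diamond missing y).
   A C4-free graph with such a partition always has a simplicial vertex, so the
   link N(x) has no cohomology in degrees >= 1, and one deletes x and inducts.

   No resolution has to be constructed: if none existed, all Betti numbers would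
   be 0 by definition.  A generator of the given minimal resolution C in too high a degree is killed by
   chasing it through the double complex Koszul (x) C, and the induced 4-cycles
   are excluded because their Koszul syzygy in degree 4 is not a combination of
   linear ones. *)

From Stdlib Require Import ClassicalEpsilon.
Require Import Defs.
From mathcomp Require Import all_boot all_order all_algebra.
From mathcomp Require Import mpoly zify ring.

Set Implicit Arguments.
Unset Strict Implicit.
Unset Printing Implicit Defensive.

Import GRing.Theory.
Local Open Scope ring_scope.

(** * Signed boundary operators on functions of finite sets *)

Definition sgn (R : comNzRingType) (n : nat) (v : 'I_n) (W : {set 'I_n}) : R :=
  (-1) ^+ #|[set w in W | (w < v)%N]|.

Lemma sgn_sqr (R : comNzRingType) (n : nat) (v : 'I_n) (W : {set 'I_n}) :
  sgn R v W * sgn R v W = 1.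
Proof. by rewrite -expr2 sqrr_sign. Qed.

Lemma sgnU1 (R : comNzRingType) (n : nat) (u v : 'I_n) (W : {set 'I_n}) :
  u \notin W -> sgn R v (u |: W) = (-1) ^+ (u < v)%N * sgn R v W.
Proof.
move=> uW; rewrite /sgn -exprD; congr (_ ^+ _).
case: ltnP => uv /=.
  rewrite add1n (_ : [set w in u |: W | (w < v)%N] = u |: [set w in W | (w < v)%N]).
    by rewrite cardsU1 inE (negPf uW).
  by apply/setP => w; rewrite !inE; case: eqP => // ->; rewrite uv.
rewrite (_ : [set w in u |: W | (w < v)%N] = [set w in W | (w < v)%N]) //.
apply/setP => w; rewrite !inE.
by case: eqP => // ->; rewrite ltnNge uv /= !andbF.
Qed.

Lemma sgn_anti (R : comNzRingType) (n : nat) (u v : 'I_n) (W : {set 'I_n}) :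
  u != v -> u \notin W -> v \notin W ->
  sgn R v W * sgn R u (v |: W) = - (sgn R u W * sgn R v (u |: W)).
Proof.
move=> uv uW vW; rewrite !sgnU1 //.
have := uv; rewrite neq_ltn => /orP[] h; rewrite h ltnNge (ltnW h) /=; ring.
Qed.

(** A chain is its coefficient function, so its boundary at [W] collects the values at the sets
    [v |: W]. With [f] constant 1 this is the augmented simplicial boundary, with ['X_v] the Koszul
    differential. *)
Definition kdiff (R : comNzRingType) (n : nat) (f : 'I_n -> R)
    (c : {set 'I_n} -> R) (W : {set 'I_n}) : R :=
  \sum_(v | v \notin W) sgn R v W * f v * c (v |: W).

(** Terms with [u < v] cancel those with [v < u]; nothing is divided by 2, so any abelian group will
    do. *)
Lemma sum_antisym (V : zmodType) (n : nat) (P : pred 'I_n)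
    (t : 'I_n -> 'I_n -> V) :
  (forall u v, u != v -> t u v = - t v u) ->
  \sum_(v | P v) \sum_(u | P u && (u != v)) t v u = 0.
Proof.
move=> anti; rewrite (eq_bigr (fun v : 'I_n =>
  \sum_(u : 'I_n | P u && (u < v)%N) t v u + \sum_(u : 'I_n | P u && (v < u)%N) t v u)).
  rewrite big_split /= [X in _ + X](exchange_big_dep P) /=; last by move=> i j _ /andP[].
  rewrite -big_split /= big1 // => v Pv.
  rewrite [X in _ + X](eq_bigl (fun u : 'I_n => P u && (u < v)%N)).
    rewrite -big_split /= big1 // => u /andP[_ uv].
    by rewrite (anti u v) ?addrN // neq_ltn uv.
  by move=> u; rewrite Pv.
move=> v Pv; rewrite (bigID (fun u : 'I_n => (u < v)%N)) /=.
congr (_ + _); apply: eq_bigl => u; rewrite -andbA; congr (_ && _).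
  by apply/andP/idP => [[]//|uv]; rewrite neq_ltn uv.
by rewrite -leqNgt ltn_neqAle eq_sym.
Qed.

Lemma kdiff_kdiff (R : comNzRingType) (n : nat) (f : 'I_n -> R)
    (c : {set 'I_n} -> R) (W : {set 'I_n}) : kdiff f (kdiff f c) W = 0.
Proof.
pose t v u := if (v \notin W) && (u \notin W) then
  (sgn R v W * f v) * (sgn R u (v |: W) * f u * c (u |: (v |: W))) else 0.
rewrite -[RHS](@sum_antisym _ _ (fun v => v \notin W) t).
  apply: eq_bigr => v vW; rewrite big_distrr /=.
  rewrite (eq_bigl (fun u => (u \notin W) && (u != v))) => [|u].
    by apply: eq_bigr => u /andP[uW _]; rewrite /t vW uW.
  by rewrite !inE negb_or andbC.
move=> u v uv; rewrite /t; case: ifP => /andP; last first.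
  by case: ifP => [/andP[-> ->] []//|_]; rewrite oppr0.
move=> [uW vW]; rewrite vW uW /= setUCA.
have := @sgn_anti R n u v W uv uW vW.
set a := sgn _ _ _; set b := sgn _ _ _; set a' := sgn _ _ _; set b' := sgn _ _ _.
move=> e; transitivity (a' * b' * (f u * f v * c (u |: (v |: W)))); first by ring.
have e' : a' * b' = - (a * b) by rewrite e opprK.
by rewrite e'; ring.
Qed.

Lemma kdiffD (R : comNzRingType) (n : nat) (f : 'I_n -> R)
    (c d : {set 'I_n} -> R) (W : {set 'I_n}) :
  kdiff f (fun W => c W + d W) W = kdiff f c W + kdiff f d W.
Proof. by rewrite -big_split; apply: eq_bigr => v _; rewrite mulrDr. Qed.

Lemma kdiffN (R : comNzRingType) (n : nat) (f : 'I_n -> R)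
    (c : {set 'I_n} -> R) (W : {set 'I_n}) :
  kdiff f (fun W => - c W) W = - kdiff f c W.
Proof. by rewrite -sumrN; apply: eq_bigr => v _; rewrite mulrN. Qed.

Lemma kdiff0 (R : comNzRingType) (n : nat) (f : 'I_n -> R)
    (c : {set 'I_n} -> R) (W : {set 'I_n}) :
  (forall W, c W = 0) -> kdiff f c W = 0.
Proof. by move=> c0; apply: big1 => v _; rewrite c0 mulr0. Qed.

Lemma eq_kdiff (R : comNzRingType) (n : nat) (f : 'I_n -> R)
    (c d : {set 'I_n} -> R) (W : {set 'I_n}) :
  (forall W, c W = d W) -> kdiff f c W = kdiff f d W.
Proof. by move=> cd; apply: eq_bigr => v _; rewrite cd. Qed.

Definition wedge (R : comNzRingType) (n : nat) (x : 'I_n)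
    (c : {set 'I_n} -> R) (W : {set 'I_n}) : R :=
  if x \in W then sgn R x (W :\ x) * c (W :\ x) else 0.

Definition contr (R : comNzRingType) (n : nat) (x : 'I_n)
    (c : {set 'I_n} -> R) (W : {set 'I_n}) : R :=
  if x \in W then 0 else sgn R x W * c (x |: W).

(** [wedge x] is exterior multiplication by the basis vector of [x], a contracting homotopy for the
    full simplex. *)
Lemma kdiff_wedge (R : comNzRingType) (n : nat) (x : 'I_n)
    (c : {set 'I_n} -> R) (W : {set 'I_n}) :
  kdiff (fun _ => 1) (wedge x c) W = c W - wedge x (kdiff (fun _ => 1) c) W.
Proof.
rewrite {2}/wedge; case: ifPn => xW; last first.
  rewrite subr0 /kdiff (bigD1 x) //= big1 ?addr0.
    by rewrite /wedge setU11 mulr1 setU1K // mulrA sgn_sqr mul1r.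
  move=> v /andP[vW vx]; rewrite /wedge !inE (negPf xW) eq_sym (negPf vx).
  by rewrite mulr0.
set V := W :\ x; have xV : x \notin V by rewrite !inE eqxx.
have WE : W = x |: V by rewrite setD1K.
move: V xV WE => V xV WE.
rewrite [kdiff (fun _ => 1) c V]/kdiff (bigD1 x) //= -WE mulr1 mulrDr mulrA sgn_sqr mul1r.
rewrite opprD addrA subrr add0r big_distrr /= -sumrN.
rewrite /kdiff (eq_bigl (fun v => (v \notin V) && (v != x))) => [|v]; last first.
  by rewrite WE !inE negb_or; case: eqP; rewrite ?andbF ?andbT.
apply: eq_bigr => v /andP[vV vx]; rewrite /wedge !mulr1.
have -> : x \in v |: W by rewrite !inE xW orbT.
have -> : (v |: W) :\ x = v |: V.
  by rewrite WE setUCA setU1K // !inE negb_or eq_sym vx.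
have := @sgn_anti R n x v V; rewrite eq_sym vx => /(_ isT xV vV) e.
have := @sgn_sqr R n x V; have := @sgn_sqr R n x (v |: V); rewrite WE.
move: e; set a := sgn _ _ _; set b := sgn _ _ _; set a' := sgn _ _ _; set b' := sgn _ _ _.
move=> e d1 a1.
have e' : a' * b' = - (a * b) by rewrite e opprK.
have -> : b' = - (a' * a * b).
  transitivity (a' * (a' * b')); first by rewrite mulrA a1 mul1r.
  by rewrite e'; ring.
transitivity (- (a' * a * (b * b) * c (v |: V))); first by ring.
by rewrite d1; ring.
Qed.

Lemma kdiff_contr (R : comNzRingType) (n : nat) (x : 'I_n)
    (c : {set 'I_n} -> R) (W : {set 'I_n}) :
  kdiff (fun _ => 1) (contr x c) W = - contr x (kdiff (fun _ => 1) c) W.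
Proof.
rewrite {2}/contr; case: ifPn => xW.
  rewrite oppr0; apply: big1 => v vW; rewrite /contr.
  by rewrite !inE xW orbT mulr0.
rewrite /kdiff (bigD1 x) //= {1}/contr setU11 mulr0 add0r big_distrr /= -sumrN.
rewrite [RHS](eq_bigl (fun v => (v \notin W) && (v != x))) => [|v]; last first.
  by rewrite !inE negb_or andbC.
apply: eq_bigr => v /andP[vW vx]; rewrite /contr !inE (negPf xW) eq_sym (negPf vx) /=.
rewrite !mulr1 !mulrA sgn_anti // ?(eq_sym x) // setUCA; ring.
Qed.

(** * Acyclicity of clique complexes *)

Definition supported (R : comNzRingType) (n : nat) (Q : pred {set 'I_n})
    (U : {set 'I_n}) (b : nat) (c : {set 'I_n} -> R) : Prop :=
  forall W, c W != 0 -> [/\ W \subset U, #|U :\: W| = b & Q (U :\: W)].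

(* The value of a chain at W is to be read as that of a relative cochain at
   U :\: W.  If the sets satisfying Q are the non-faces of a simplicial complex
   on U, then [acyc R Q U b] says that its reduced cohomology vanishes in degree
   b - 2. *)
Definition acyc (R : comNzRingType) (n : nat) (Q : pred {set 'I_n})
    (U : {set 'I_n}) (b : nat) : Prop :=
  forall c : {set 'I_n} -> R, supported Q U b c ->
    (forall W, kdiff (fun _ => 1) c W = 0) ->
  exists d : {set 'I_n} -> R,
    (forall W, d W != 0 -> [/\ W \subset U, #|U :\: W|.+1 = b & Q (U :\: W)]) /\
    (forall W, kdiff (fun _ => 1) d W = c W).

Lemma acyc_zero (R : comNzRingType) (n : nat) (Q : pred {set 'I_n})
    (U : {set 'I_n}) (b : nat) :
  (forall W : {set 'I_n}, W \subset U -> #|U :\: W| = b -> Q (U :\: W) -> False) ->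
  acyc R Q U b.
Proof.
move=> no c sc _; exists (fun _ => 0); split=> W; first by rewrite eqxx.
rewrite kdiff0 //; apply/esym/eqP; apply: contraT => /sc[].
by move=> h1 h2 h3; case: (no W).
Qed.

Lemma acyc_ext (R : comNzRingType) (n : nat) (Q Q' : pred {set 'I_n})
    (U : {set 'I_n}) (b : nat) :
  (forall A : {set 'I_n}, A \subset U -> Q A = Q' A) -> acyc R Q U b -> acyc R Q' U b.
Proof.
move=> QQ aQ c sc bc; have [|d [sd bdE]] := aQ c _ bc.
  by move=> W /sc[h1 h2 h3]; split=> //; rewrite QQ // subsetDl.
exists d; split=> // W /sd[h1 h2 h3]; split=> //.
by rewrite -QQ // subsetDl.
Qed.

(** The homotopy [wedge x] adds [x] to [W], hence removes it from [U :\: W]; the hypothesis on [Q]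
    keeps it inside the relative chains. *)
Lemma acyc_cone (R : comNzRingType) (n : nat) (Q : pred {set 'I_n})
    (U : {set 'I_n}) (b : nat) (x : 'I_n) :
  x \in U -> (forall A : {set 'I_n}, A \subset U -> Q A -> Q (A :\ x)) -> acyc R Q U b.
Proof.
move=> xU Qx c sc bc; exists (wedge x c); split=> W; last first.
  rewrite kdiff_wedge /wedge; case: ifP => _; last by rewrite subr0.
  by rewrite bc mulr0 subr0.
rewrite /wedge; case: ifPn => [xW|]; last by rewrite eqxx.
move=> nz; have /sc[WU Wb QW] : c (W :\ x) != 0.
  by apply: contraNneq nz => ->; rewrite mulr0.
have E : U :\: W = (U :\: (W :\ x)) :\ x.
  by apply/setP=> y; rewrite !inE; case: eqP => // ->; rewrite xW.
split.
- by rewrite -(setD1K xW) subUset sub1set xU.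
- by rewrite E -Wb [RHS](cardsD1 x) !inE eqxx xU.
- by rewrite E; apply: Qx => //; apply: subsetDl.
Qed.

(* Deleting x gives the quotient complex of the chains that contain x, and
   linking with x gives the subcomplex of the chains that avoid it. *)
Lemma acyc_del_link (R : comNzRingType) (n : nat) (Q : pred {set 'I_n})
    (U : {set 'I_n}) (b : nat) (x : 'I_n) :
  x \in U -> (forall A : {set 'I_n}, Q A -> Q (x |: A)) ->
  acyc R Q (U :\ x) b.+1 -> acyc R (fun A => Q (x |: A)) (U :\ x) b ->
  acyc R Q U b.+1.
Proof.
move=> xU Qup adel alink c sc bc.
have DE (W : {set 'I_n}) : (U :\ x) :\: W = U :\: (x |: W).
  by apply/setP=> y; rewrite !inE negb_or; case: (y == x); rewrite /= ?andbF.
have DD (W : {set 'I_n}) : x \notin W -> U :\: W = x |: ((U :\ x) :\: W).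
  by move=> xW; apply/setP=> y; rewrite !inE; case: eqP => //= ->; rewrite xW.
have DC (W : {set 'I_n}) : x \notin W -> #|U :\: W| = #|(U :\ x) :\: W|.+1.
  by move=> xW; rewrite DD // cardsU1 !inE eqxx /= andbF.
have subD (W : {set 'I_n}) : W \subset U -> x \notin W -> W \subset U :\ x.
  by move=> WU xW; rewrite subsetD1 WU.
(* In the quotient complex only the values at sets containing [x] remain; [d0] bounds them. *)
have [||d0 [sd0 bd0E]] := adel (contr x c).
- move=> W; rewrite /contr; case: ifPn => [|xW nz]; first by rewrite eqxx.
  have /sc[h1 h2 h3] : c (x |: W) != 0.
    by apply: contraNneq nz => ->; rewrite mulr0.
  split; rewrite ?DE //; apply: subD => //.
  by apply: subset_trans h1; apply: subsetUr.
- by move=> W; rewrite kdiff_contr /contr bc mulr0 if_same oppr0.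
have sd0x W : d0 W != 0 -> x \notin W.
  by case/sd0 => /subsetD1P[].
(* This boundary cancels [c] at every set containing [x], so [c1] lies in the subcomplex given by
   the link. *)
pose c1 W := c W + kdiff (fun _ => 1) (wedge x d0) W.
have c1E W : c1 W = (if x \in W then 0 else c W) + d0 W.
  rewrite /c1 kdiff_wedge /wedge; case: ifPn => xW; last by rewrite subr0.
  rewrite bd0E /contr !inE eqxx /= setD1K // mulrA sgn_sqr mul1r; ring.
have [||d1 [sd1 bd1E]] := alink c1.
- move=> W; rewrite c1E => nz.
  have xW : x \notin W.
    apply: contraTN nz => xW; rewrite xW add0r negbK.
    by apply: contraTT xW; apply: sd0x.
  move: nz; rewrite (negPf xW); have [-> |/sd0[h1 h2 h3] _] := eqVneq (d0 W) 0.
    rewrite addr0 => /sc[h1 h2 h3]; split; first exact: subD.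
      by move: h2; rewrite DC // => -[].
    by rewrite -DD.
  by case: h2 => <-; split=> //; apply: Qup.
- by move=> W; rewrite kdiffD bc kdiff_kdiff addr0.
exists (fun W => d1 W - wedge x d0 W); split=> W; last first.
  by rewrite kdiffD kdiffN bd1E /c1 addrK.
have [-> |/sd1[h1 h2 h3] _] := eqVneq (d1 W) 0; last first.
  have /subsetD1P[WU xW] := h1.
  by split=> //; [rewrite DC // h2 | rewrite DD].
rewrite sub0r oppr_eq0 /wedge; case: ifPn => [xW nz|]; last by rewrite eqxx.
have /sd0[h1 h2 h3] : d0 (W :\ x) != 0.
  by apply: contraNneq nz => ->; rewrite mulr0.
have E : (U :\ x) :\: (W :\ x) = U :\: W by rewrite DE setD1K.
rewrite -E; split=> //.
by rewrite -(setD1K xW) subUset sub1set xU (subset_trans h1) ?subD1set.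
Qed.

Lemma acyc_true (R : comNzRingType) (n : nat) (U : {set 'I_n}) (b : nat) :
  ((0 < b) || (U != set0))%N -> acyc R xpredT U b.
Proof.
have [-> | [x xU] _] := set_0Vmem U; last exact: acyc_cone xU _.
rewrite eqxx orbF => b0; apply: acyc_zero => W _.
by rewrite set0D cards0 => b1; rewrite -b1 in b0.
Qed.

(** A vertex outside [N] is itself a non-face, so every set containing it is one and its link term
    is covered by [acyc_true]. Deleting such vertices one by one leaves [U :&: N]. *)
Lemma acyc_ghost (R : comNzRingType) (n : nat) (Q : pred {set 'I_n})
    (U N : {set 'I_n}) (b : nat) :
  (forall (A B : {set 'I_n}), A \subset B -> Q A -> Q B) ->
  (forall x, x \in U -> x \notin N -> Q [set x]) ->
  acyc R Q (U :&: N) b.+2 -> acyc R Q U b.+2.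
Proof.
move=> Qup; elim: {U}#|U| {-2}U (erefl #|U|) => [|m IH] U Um gh aN.
  have /eqP := Um; rewrite cards_eq0 => /eqP U0.
  by rewrite U0 set0I -U0 in aN.
have [UN|/subsetPn[x xU xN]] := boolP (U \subset N).
  by rewrite (setIidPl UN) in aN.
apply: (@acyc_del_link _ _ _ _ _ x) => // [A||].
- by apply: Qup; apply: subsetUr.
- apply: IH => [|y|].
  + by have := cardsD1 x U; rewrite xU Um => -[].
  + by rewrite !inE => /andP[_ yU]; apply: gh.
  + rewrite (_ : _ :&: _ = U :&: N) //; apply/setP=> y; rewrite !inE.
    by case: eqP => // ->; rewrite (negPf xN) !andbF.
- apply: acyc_ext (@acyc_true R n (U :\ x) b.+1 _) => // A _.
  by apply/esym; apply: (Qup _ _ _ (gh x xU xN)); apply: subsetUl.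
Qed.

Section CliqueComplexes.

Variables (n : nat) (G : graph n).

Definition clique (A : {set 'I_n}) : bool :=
  [forall x in A, forall y in A, (x != y) ==> G x y].

Definition nbr (x : 'I_n) : {set 'I_n} := [set y | G x y].

Lemma cliqueP (A : {set 'I_n}) :
  reflect (forall x y, x \in A -> y \in A -> x != y -> G x y) (clique A).
Proof.
apply: (iffP forall_inP) => [h x y xA yA xy | h x xA].
  by have /forall_inP/(_ y yA)/implyP/(_ xy) := h x xA.
by apply/forall_inP => y yA; apply/implyP; apply: h.
Qed.

Lemma cliquePn (A : {set 'I_n}) :
  ~~ clique A -> exists x y, [/\ x \in A, y \in A, x != y & ~~ G x y].
Proof.
rewrite negb_forall => /existsP[x]; rewrite negb_imply => /andP[xA].
rewrite negb_forall => /existsP[y]; rewrite negb_imply => /andP[yA].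
by rewrite negb_imply => /andP[xy nG]; exists x, y.
Qed.

Lemma sub_clique (A B : {set 'I_n}) : A \subset B -> clique B -> clique A.
Proof.
move=> /subsetP AB /cliqueP h; apply/cliqueP => x y /AB xB /AB yB; exact: h.
Qed.

Lemma cliqueU1 (x : 'I_n) (A : {set 'I_n}) :
  A \subset nbr x -> clique (x |: A) = clique A.
Proof.
move=> /subsetP Ax; apply/idP/idP; first by apply: sub_clique; apply: subsetUr.
move=> /cliqueP h; apply/cliqueP => u v; rewrite !inE.
case/predU1P=> [->|uA]; case/predU1P=> [->|vA] uv; last exact: h.
- by rewrite eqxx in uv.
- by have := Ax _ vA; rewrite inE.
- by have := Ax _ uA; rewrite inE adj_sym.
Qed.

Definition clique_acyc (R : comNzRingType) (U : {set 'I_n}) (b : nat) : Prop :=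
  acyc R (fun A => ~~ clique A) U b.

Lemma clique_acyc_clique (R : comNzRingType) (U : {set 'I_n}) (b : nat) :
  clique U -> clique_acyc R U b.
Proof.
move=> cU; apply: acyc_zero => A _ _; apply/negP; rewrite negbK.
exact: sub_clique (subsetDl _ _) cU.
Qed.

(** In the link of [x] the non-neighbours of [x] are ghost vertices; on the neighbours the link is
    again a clique complex. *)
Lemma clique_acyc_step (R : comNzRingType) (U : {set 'I_n}) (b : nat) (x : 'I_n) :
  x \in U -> clique_acyc R (U :&: nbr x) b.+2 ->
  clique_acyc R (U :\ x) b.+3 -> clique_acyc R U b.+3.
Proof.
move=> xU alink adel; apply: (acyc_del_link xU) => //.
  by move=> A; apply: contra; apply: sub_clique; apply: subsetUr.
apply: (@acyc_ghost _ _ _ _ (nbr x)).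
- by move=> A B AB; apply: contra; apply: sub_clique; apply: setUS.
- move=> y; rewrite !inE => /andP[yx _]; apply: contra => /cliqueP h.
  by apply: h; rewrite ?set21 ?set22 1?eq_sym.
have -> : (U :\ x) :&: nbr x = U :&: nbr x.
  by apply/setP=> y; rewrite !inE; case: eqP => // ->; rewrite adj_irr !andbF.
apply: acyc_ext alink => A /subsetIP[_ Ax].
by rewrite cliqueU1.
Qed.

End CliqueComplexes.

(** * Graphs without induced 4-cycles and without induced [F] *)

Definition C4_free (n : nat) (G : graph n) : Prop :=
  forall a b c d, G a b -> G b c -> G c d -> G d a -> a != c -> b != d ->
  G a c || G b d.

Lemma F_free_diamond (n : nat) (G : graph n) (x y a b c : 'I_n) :
  ~ induced_subgraph F_graph G -> x != y -> ~~ G x y ->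
  G x a -> G x b -> G x c -> ~~ G y a -> ~~ G y b -> ~~ G y c ->
  G a b -> G b c -> a != c -> G a c.
Proof.
move=> hF xy nxy xa xb xc nya nyb nyc ab bc ac; apply: contraT => nac.
have neq u v : G u v -> u != v.
  by apply: contraTneq => ->; rewrite adj_irr.
have neqy u : G x u -> y != u by apply: contraTneq => <-.
have nyx : ~~ G y x by rewrite adj_sym.
(* In the numbering of [F_graph], [y] is the isolated vertex 0, and [x], [b] span the shared edge
   23. *)
pose f (i : 'I_5) := tnth [tuple y; a; x; b; c] i.
case: hF; exists f.
  apply/injectiveP; rewrite /injectiveb /dinjectiveb.
  rewrite (map_tnth_enum [tuple y; a; x; b; c]).
  rewrite /= !inE !negb_or (neqy a) ?(neqy b) ?(neqy c) // (eq_sym y) xy.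
  by rewrite (eq_sym a x) (neq x a) ?(neq a b) ?(neq x b) ?(neq x c) ?(neq b c) ?ac.
have sym u v : G u v -> G v u by rewrite adj_sym.
have nsym u v : ~~ G u v -> ~~ G v u by rewrite adj_sym.
have T u v : G u v -> G u v = true by [].
have N u v : ~~ G u v -> G u v = false by move/negbTE.
move=> [[|[|[|[|[|//]]]]] i] [[|[|[|[|[|//]]]]] j];
  rewrite /F_graph /F_adj /f /tnth /= ?adj_irr //;
  by [apply: T; auto | apply: N; auto].
Qed.

(* A vertex v outside K with the fewest neighbours in K is simplicial, because
   C4-freeness makes the sets N(v) :&: K nested along adjacent vertices. *)
Lemma clique_acyc_split (R : comNzRingType) (n : nat) (G : graph n)
    (K U : {set 'I_n}) (b : nat) :
  C4_free G -> clique G K ->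
  (forall p q r, p \in U :\: K -> q \in U :\: K -> r \in U :\: K ->
    G p q -> G q r -> p != r -> G p r) ->
  clique_acyc G R U b.+3.
Proof.
move=> C4 cK; elim: {U}#|U| {-2}U (erefl #|U|) => [|m IH] U Um P3.
  have /eqP := Um; rewrite cards_eq0 => /eqP ->.
  by apply: clique_acyc_clique; apply/cliqueP => x y; rewrite inE.
have [UK|/subsetPn[v0 v0U v0K]] := boolP (U \subset K).
  by apply: clique_acyc_clique; apply: sub_clique cK.
pose N v := (U :&: K) :&: nbr G v.
have Pv0 : v0 \in U :\: K by rewrite inE v0K.
case: (@arg_minnP _ v0 (mem (U :\: K)) (fun v => #|N v|) Pv0) => v vUK vmin.
have /setDP[vU vK] := vUK.
(* Otherwise minimality of [N v] yields [r] in [N q] but not in [N v], and [v], [q], [r], [p] form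
   an induced 4-cycle. *)
have key p q : p \in U -> p \in K -> G v p -> q \in U :\: K -> G v q -> G p q.
  move=> pU pK vp qUK vq; apply: contraT => npq.
  have /setDP[qU qK] := qUK.
  have /subsetPn[r] : ~~ (N q \subset N v).
    apply/negP => sub.
    have := vmin q qUK; rewrite leqNgt => /negP; apply.
    apply: proper_card; rewrite properE sub; apply/subsetPn; exists p.
      by rewrite !inE pU pK.
    by rewrite !inE pU pK adj_sym.
  rewrite !inE => /andP[/andP[rU rK] qr]; rewrite rU rK /= => nvr.
  have rp : r != p by apply: contraNneq npq => <-; rewrite adj_sym.
  have Grp : G r p by move/cliqueP: cK; apply.
  have vr : v != r by apply: contraNneq vK => ->.
  have qp : q != p by apply: contraNneq qK => ->.
  have := C4 v q r p vq qr Grp; rewrite adj_sym => /(_ vp vr qp).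
  by rewrite (negPf nvr) adj_sym (negPf npq).
apply: (clique_acyc_step vU).
  (* The neighbours of [v] in [U] form a clique: pairs inside [K] by [cK], mixed pairs by [key],
     pairs outside [K] by [P3] through [v]. *)
  apply: clique_acyc_clique; apply/cliqueP => p q; rewrite !inE.
  move=> /andP[pU vp] /andP[qU vq] pq.
  have [pK|pK] := boolP (p \in K); have [qK|qK] := boolP (q \in K).
  - by move/cliqueP: cK; apply.
  - by apply: key => //; rewrite inE qK.
  - by rewrite adj_sym; apply: key => //; rewrite inE pK.
  - by apply: (P3 p v q); rewrite ?inE ?pK ?qK ?vK // adj_sym.
apply: IH; first by have := cardsD1 v U; rewrite vU Um => -[].
have sub p : p \in (U :\ v) :\: K -> p \in U :\: K.
  by apply/subsetP; apply: setSD; apply: subD1set.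
by move=> p q r /sub pU /sub qU /sub rU; apply: P3.
Qed.

(** The index [b.+4] means cohomological degree at least 2. The link of [x] is needed one degree
    lower, which [clique_acyc_split] provides. *)
Lemma clique_acyc_free (R : comNzRingType) (n : nat) (G : graph n)
    (U : {set 'I_n}) (b : nat) :
  C4_free G -> ~ induced_subgraph F_graph G -> clique_acyc G R U b.+4.
Proof.
move=> C4 hF; elim: {U}#|U| {-2}U (erefl #|U|) => [|m IH] U Um.
  have /eqP := Um; rewrite cards_eq0 => /eqP ->.
  by apply: clique_acyc_clique; apply/cliqueP => x y; rewrite inE.
have [cU|/cliquePn[x [y [xU yU xy nxy]]]] := boolP (clique G U).
  exact: clique_acyc_clique.
apply: (clique_acyc_step xU); last first.
  by apply: IH; have := cardsD1 x U; rewrite xU Um => -[].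
apply: (@clique_acyc_split _ _ _ (nbr G x :&: nbr G y)) => //.
  apply/cliqueP => p q; rewrite !inE => /andP[xp yp] /andP[xq yq] pq.
  have := C4 x p y q xp; rewrite (negPf nxy) (adj_sym G p) (adj_sym G q).
  by apply.
move=> p q r; rewrite !inE !negb_and => /andP[np /andP[_ xp]].
move=> /andP[nq /andP[_ xq]] /andP[nr /andP[_ xr]].
move: np nq nr; rewrite xp xq xr /= => yp yq yr.
exact: (F_free_diamond hF xy nxy).
Qed.

(** * Multigraded strands of the Koszul complex *)

Definition set_mnm (n : nat) (W : {set 'I_n}) : 'X_{1..n} :=
  [multinom (i \in W : nat) | i < n].

Definition mnm_set (n : nat) (m : 'X_{1..n}) : {set 'I_n} :=
  [set i | (0 < m i)%N].

Lemma mdeg_set_mnm (n : nat) (W : {set 'I_n}) : mdeg (set_mnm W) = #|W|.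
Proof.
rewrite mdegE -sum1_card [RHS]big_mkcond /=; apply: eq_bigr => i _.
by rewrite mnmE; case: (i \in W).
Qed.

Lemma sub_set_mnm (n : nat) (m : 'X_{1..n}) (W : {set 'I_n}) :
  W \subset mnm_set m -> (m - set_mnm W + set_mnm W)%MM = m.
Proof.
move=> /subsetP sub; apply/mnmP => i; rewrite mnmDE mnmBE mnmE.
by case: (boolP (i \in W)) => [/sub|]; rewrite ?inE ?subn0 ?addn0 // => /subnK.
Qed.

Lemma add_set_mnm (n : nat) (m : 'X_{1..n}) (W : {set 'I_n}) :
  (m + set_mnm W - set_mnm W)%MM = m.
Proof. exact: addmK. Qed.

Lemma mnm_set_add (n : nat) (m : 'X_{1..n}) (W : {set 'I_n}) :
  W \subset mnm_set (m + set_mnm W)%MM.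
Proof. by apply/subsetP => i iW; rewrite inE mnmDE mnmE iW addn1. Qed.

Lemma mcoeff_sgn (k : fieldType) (n : nat) (v : 'I_n) (W : {set 'I_n})
    (p : {mpoly k[n]}) (m : 'X_{1..n}) :
  (sgn {mpoly k[n]} v W * p)@_m = sgn k v W * p@_m.
Proof.
rewrite /sgn -signr_odd -[in RHS]signr_odd; case: (odd _).
  by rewrite !expr1 !mulN1r mcoeffN.
by rewrite !expr0 !mul1r.
Qed.

Lemma mcoeff_mulX (k : fieldType) (n : nat) (v : 'I_n) (p : {mpoly k[n]})
    (m : 'X_{1..n}) :
  ('X_v * p)@_m = if (0 < m v)%N then p@_(m - U_(v)) else 0.
Proof.
rewrite mulrC; case: ifPn => mv.
  have le : (U_(v) <= m)%MM.
    by apply/mnm_lepP => i; rewrite mnm1E; case: eqP => // <-.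
  by rewrite -{1}(submK le) addmC mcoeffMX.
apply/eqP; rewrite mcoeff_eq0 (perm_mem (msuppMX _ _)); apply/mapP => -[m' _ E].
by rewrite E mnmDE mnm1E eqxx in mv.
Qed.

Definition kos (k : fieldType) (n : nat) :
    ({set 'I_n} -> {mpoly k[n]}) -> {set 'I_n} -> {mpoly k[n]} :=
  kdiff (fun v => 'X_v).

(* The part of a Koszul chain in multidegree m, the basis vector indexed by W
   having multidegree set_mnm W. *)
Definition slice (k : fieldType) (n : nat) (c : {set 'I_n} -> {mpoly k[n]})
    (m : 'X_{1..n}) (W : {set 'I_n}) : k :=
  if W \subset mnm_set m then (c W)@_(m - set_mnm W) else 0.

Lemma slice_add (k : fieldType) (n : nat) (c : {set 'I_n} -> {mpoly k[n]})
    (m : 'X_{1..n}) (W : {set 'I_n}) :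
  slice c (m + set_mnm W) W = (c W)@_m.
Proof. by rewrite /slice mnm_set_add add_set_mnm. Qed.

(** Multiplying by ['X_v] restores the degree lost by dropping [v] from the index, so within one
    multidegree every variable acts as 1. *)
Lemma slice_kos (k : fieldType) (n : nat) (c : {set 'I_n} -> {mpoly k[n]})
    (m : 'X_{1..n}) (W : {set 'I_n}) :
  slice (kos c) m W = kdiff (fun _ => 1) (slice c m) W.
Proof.
rewrite {1}/slice; case: ifPn => [Wm|Wm]; last first.
  apply/esym; apply: big1 => v _; rewrite /slice ifN ?mulr0 //.
  by apply: contraNN Wm; apply: subset_trans; apply: subsetUr.
rewrite /kos /kdiff raddf_sum /=; apply: eq_bigr => v vW.
rewrite -mulrA mcoeff_sgn mcoeff_mulX mulr1 /slice subUset sub1set Wm andbT.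
rewrite mnmBE mnmE (negPf vW) subn0 inE; case: ifP => _ //; congr (_ * _@_ _).
apply/mnmP => i; rewrite !mnmBE !mnmE !inE eq_sym.
by case: eqP => [->|_] /=; rewrite ?(negPf vW) ?subn0.
Qed.

(** [J] selects the allowed monomials and [D] the total degrees. Since [kos] preserves multidegree,
    the equation is solved strand by strand and the solutions are summed. *)
Lemma multigraded_exact (k : fieldType) (n : nat) (J : pred 'X_{1..n})
    (D : pred nat) (p : nat) (c : {set 'I_n} -> {mpoly k[n]}) :
  (forall W m, (c W)@_m != 0 -> [/\ #|W| = p, D (mdeg m + #|W|)%N & J m]) ->
  (p = 0%N -> (c set0)@_0%MM = 0) ->
  (forall W, kos c W = 0) ->
  (forall m, D (mdeg m) -> (0 < mdeg m)%N ->
     acyc k (fun A => J (m - set_mnm (mnm_set m :\: A))%MM)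
       (mnm_set m) (#|mnm_set m| - p)) ->
  exists d : {set 'I_n} -> {mpoly k[n]},
    (forall W m, (d W)@_m != 0 -> [/\ #|W| = p.+1, D (mdeg m + #|W|)%N & J m]) /\
    (forall W, kos d W = c W).
Proof.
move=> sc c0 cyc ac.
have sliceP m W : slice c m W != 0 ->
    [/\ W \subset mnm_set m, #|W| = p, D (mdeg m), (0 < mdeg m)%N
      & J (m - set_mnm W)%MM].
  rewrite /slice; case: ifPn => [Wm nz|]; last by rewrite eqxx.
  have [Wp DW JW] := sc _ _ nz.
  have mE := congr1 (@mdeg n) (sub_set_mnm Wm); rewrite mdegD mdeg_set_mnm in mE.
  split=> //; first by rewrite -mE.
  (* In multidegree 0 only the constant term at the empty set could survive, and [c0] excludes
     it. *)
  rewrite lt0n mdeg_eq0; apply: contra_neq nz => m0.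
  have W0 : W = set0.
    apply/eqP; rewrite -subset0; apply: subset_trans Wm _.
    by apply/subsetP => i; rewrite inE m0 mnm0E.
  rewrite W0 m0 -[RHS]c0 -?Wp ?W0 ?cards0 //; congr _@_ _.
  by apply/mnmP => i; rewrite mnmBE mnm0E.
(* All strands of degree at least [b] vanish, so the reassembled sum is finite; [n] allows for the
   degree of the index set. *)
pose b := (\max_(W : {set 'I_n}) msize (c W) + n)%N.
have sliceb m : (b <= mdeg m)%N -> forall W, slice c m W = 0.
  move=> bm W; rewrite /slice; case: ifPn => // Wm; apply/eqP.
  rewrite mcoeff_eq0; apply: msize_mdeg_ge.
  have mE := congr1 (@mdeg n) (sub_set_mnm Wm); rewrite mdegD mdeg_set_mnm in mE.
  have h1 : (#|W| <= n)%N by rewrite -[leqRHS]card_ord max_card.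
  have h2 : (msize (c W) <= \max_W msize (c W))%N by exact: leq_bigmax.
  have := leq_add h2 h1; rewrite -/b => /leq_trans/(_ bm).
  by rewrite -mE leq_add2r.
have slices m : exists e : {set 'I_n} -> k,
    (forall W, e W != 0 -> [/\ W \subset mnm_set m, #|W| = p.+1, D (mdeg m),
       (mdeg m < b)%N & J (m - set_mnm W)%MM]) /\
    (forall W, kdiff (fun _ => 1) e W = slice c m W).
  have [/existsP[W0 nz]|] := boolP [exists W, slice c m W != 0]; last first.
    move=> /existsPn z; exists (fun _ => 0); split=> W; first by rewrite eqxx.
    by rewrite kdiff0 //; apply/esym/eqP; apply: negbNE.
  have [W0m W0p Dm m0 _] := sliceP _ _ nz.
  have mb : (mdeg m < b)%N.
    by rewrite ltnNge; apply: contraNN nz => /sliceb ->.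
  have DD (W : {set 'I_n}) : W \subset mnm_set m ->
      mnm_set m :\: (mnm_set m :\: W) = W.
    by move=> Wm; rewrite setDDr setDv set0U; apply/setIidPr.
  have DC (W : {set 'I_n}) : W \subset mnm_set m ->
      #|mnm_set m :\: W| = (#|mnm_set m| - #|W|)%N.
    by move=> Wm; rewrite cardsD; have /setIidPr -> := Wm.
  have [W /sliceP[Wm Wp _ _ JW]|W|e [se be]] := ac m Dm m0 (slice c m).
  - by split; rewrite ?DD // DC // Wp.
  - by rewrite -slice_kos /slice cyc mcoeff0 if_same.
  exists e; split=> // W /se[Wm WE JW]; split=> //; last by rewrite -(DD W).
  have := subset_leq_card Wm; have := subset_leq_card W0m; rewrite W0p.
  by move: WE; rewrite DC //; lia.
pose e m := sval (constructive_indefinite_description _ (slices m)).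
have se m W : e m W != 0 -> [/\ W \subset mnm_set m, #|W| = p.+1, D (mdeg m),
    (mdeg m < b)%N & J (m - set_mnm W)%MM].
  by rewrite /e; case: constructive_indefinite_description => /= ? [h _]; apply: h.
have be m W : kdiff (fun _ => 1) (e m) W = slice c m W.
  by rewrite /e; case: constructive_indefinite_description => /= ? [_ ->].
pose d W := \sum_(m : 'X_{1..n < b}) e m W *: 'X_[(m - set_mnm W)%MM] : {mpoly k[n]}.
have dE W m : (d W)@_m = e (m + set_mnm W)%MM W.
  rewrite raddf_sum /=.
  have [mb|mb] := ltnP (mdeg (m + set_mnm W)%MM) b.
    rewrite (bigD1 (BMultinom mb)) //= mcoeffZ mcoeffX add_set_mnm eqxx mulr1.
    rewrite big1 ?addr0 // => m' ne; rewrite mcoeffZ mcoeffX.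
    have [-> |/se[Wm _ _ _ _]] := eqVneq (e m' W) 0; first by rewrite mul0r.
    case: eqP => [E|]; last by rewrite mulr0.
    by case/eqP: ne; apply/val_inj => /=; rewrite -E sub_set_mnm.
  have -> : e (m + set_mnm W)%MM W = 0.
    by apply/eqP; apply: contraTT mb => /se[_ _ _ h _]; rewrite -ltnNge.
  apply: big1 => m' _; rewrite mcoeffZ mcoeffX.
  have [-> |/se[Wm _ _ _ _]] := eqVneq (e m' W) 0; first by rewrite mul0r.
  case: eqP => [E|]; last by rewrite mulr0.
  by move: mb; rewrite -E sub_set_mnm // leqNgt bmdeg.
exists d; split=> W.
  move=> m; rewrite dE => /se[Wm Wp Dm _ Jm].
  by rewrite add_set_mnm in Jm; rewrite mdegD mdeg_set_mnm in Dm.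
apply/mpolyP => m; rewrite -!slice_add slice_kos -be; apply: eq_kdiff => W'.
rewrite /slice; case: ifPn => W'm; first by rewrite dE sub_set_mnm.
by apply/esym/eqP; apply: contraNT W'm => /se[].
Qed.

Lemma mcoeffM_neq0 (k : fieldType) (n : nat) (p q : {mpoly k[n]})
    (m : 'X_{1..n}) :
  (p * q)@_m != 0 ->
  exists m1 m2, [/\ p@_m1 != 0, q@_m2 != 0 & m = (m1 + m2)%MM].
Proof.
rewrite -mcoeff_msupp => /msuppM_le/allpairsP[[m1 m2] /= [h1 h2 ->]].
by exists m1, m2; rewrite -!mcoeff_msupp.
Qed.

Lemma sum_neq0 (V : zmodType) (I : finType) (P : pred I) (F : I -> V) :
  \sum_(i | P i) F i != 0 -> exists2 i, P i & F i != 0.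
Proof.
move=> nz; have [/existsP[i /andP[]]|] := boolP [exists i, P i && (F i != 0)].
  by exists i.
move=> /existsPn z; case/eqP: nz; apply: big1 => i Pi.
by have := z i; rewrite Pi negbK => /eqP.
Qed.

Lemma mulmx_mcoeff_neq0 (k : fieldType) (n q r : nat)
    (u : 'rV[{mpoly k[n]}]_q) (M : 'M_(q, r)) (b : 'I_r) (m : 'X_{1..n}) :
  ((u *m M) 0 b)@_m != 0 ->
  exists a m1 m2, [/\ (u 0 a)@_m1 != 0, (M a b)@_m2 != 0 & m = (m1 + m2)%MM].
Proof.
rewrite mxE raddf_sum => /sum_neq0[a _] /mcoeffM_neq0[m1 [m2 h]].
by exists a, m1, m2.
Qed.

(** * Koszul complexes with coefficients in a free module *)

Definition kosr (k : fieldType) (n q : nat)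
    (c : {set 'I_n} -> 'rV[{mpoly k[n]}]_q) (W : {set 'I_n}) :
    'rV[{mpoly k[n]}]_q :=
  \row_b kos (fun W => c W 0 b) W.

Lemma kosr_mulmx (k : fieldType) (n q r : nat) (M : 'M[{mpoly k[n]}]_(q, r))
    (c : {set 'I_n} -> 'rV_q) (W : {set 'I_n}) :
  kosr (fun W => c W *m M) W = kosr c W *m M.
Proof.
apply/rowP => b; rewrite !mxE /kos /kdiff.
under eq_bigr => v _ do rewrite mxE big_distrr /=.
rewrite exchange_big /=; apply: eq_bigr => a _; rewrite mxE big_distrl /=.
by apply: eq_bigr => v _; rewrite mulrA.
Qed.

Lemma eq_kosr (k : fieldType) (n q : nat)
    (c d : {set 'I_n} -> 'rV[{mpoly k[n]}]_q) (W : {set 'I_n}) :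
  (forall W, c W = d W) -> kosr c W = kosr d W.
Proof. by move=> cd; apply/rowP => b; rewrite !mxE; apply: eq_kdiff => V; rewrite cd. Qed.

Lemma kosrD (k : fieldType) (n q : nat)
    (c d : {set 'I_n} -> 'rV[{mpoly k[n]}]_q) (W : {set 'I_n}) :
  kosr (fun W => c W + d W) W = kosr c W + kosr d W.
Proof.
apply/rowP => b; rewrite !mxE -kdiffD; apply: eq_kdiff => V; by rewrite mxE.
Qed.

Lemma kosr_kosr (k : fieldType) (n q : nat)
    (c : {set 'I_n} -> 'rV[{mpoly k[n]}]_q) (W : {set 'I_n}) :
  kosr (kosr c) W = 0.
Proof.
apply/rowP => b; rewrite !mxE /= -[RHS](kdiff_kdiff (fun v => 'X_v) (fun W => c W 0 b) W).
by apply: eq_kdiff => V; rewrite mxE.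
Qed.

Lemma mcoeff0_kos (k : fieldType) (n : nat) (c : {set 'I_n} -> {mpoly k[n]})
    (W : {set 'I_n}) : (kos c W)@_0%MM = 0.
Proof.
rewrite raddf_sum; apply: big1 => v _ /=.
by rewrite -mulrA mcoeff_sgn mcoeff_mulX mnm0E mulr0.
Qed.

(** With all monomials allowed, each strand of positive degree is the chain complex of a full
    simplex on a nonempty support. [D] depends on the coordinate in order to record shifts. *)
Lemma kosr_exact (k : fieldType) (n q p : nat) (D : 'I_q -> pred nat)
    (c : {set 'I_n} -> 'rV[{mpoly k[n]}]_q) :
  (forall W b m, (c W 0 b)@_m != 0 -> #|W| = p /\ D b (mdeg m + #|W|)%N) ->
  (p = 0%N -> forall b, (c set0 0 b)@_0%MM = 0) ->
  (forall W, kosr c W = 0) ->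
  exists d : {set 'I_n} -> 'rV[{mpoly k[n]}]_q,
    (forall W b m, (d W 0 b)@_m != 0 ->
       #|W| = p.+1 /\ D b (mdeg m + #|W|)%N) /\
    (forall W, kosr d W = c W).
Proof.
move=> sc c0 cyc.
have ex b : exists d : {set 'I_n} -> {mpoly k[n]},
    (forall W m, (d W)@_m != 0 ->
       [/\ #|W| = p.+1, D b (mdeg m + #|W|)%N & xpredT m]) /\
    (forall W, kos d W = c W 0 b).
  apply: multigraded_exact => [W m /sc[h1 h2]|p0|W|m _ m0] //.
  - exact: c0.
  - by have /rowP/(_ b) := cyc W; rewrite !mxE.
  apply: acyc_true; apply/orP; right; apply: contraTneq m0 => m0.
  rewrite -eqn0Ngt mdeg_eq0; apply/eqP/mnmP => i; rewrite mnm0E.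
  by have /setP/(_ i) := m0; rewrite !inE lt0n => /negbFE/eqP.
have [d dP] := fin_all_exists ex.
exists (fun W => \row_b d b W); split=> W.
  by move=> b m; rewrite mxE => /(proj1 (dP b))[].
apply/rowP => b; rewrite mxE -(proj2 (dP b)); apply: eq_kdiff => V.
by rewrite mxE.
Qed.

(** * The non-edge ideal as a monomial ideal *)

Definition nonedge_mnm (n : nat) (G : graph n) : pred 'X_{1..n} := fun m =>
  [exists u, exists v, [&& u != v, ~~ G u v, 0 < m u & 0 < m v]%N].

Lemma nonedge_mnmP (n : nat) (G : graph n) (m : 'X_{1..n}) :
  reflect (exists u v, [/\ u != v, ~~ G u v, 0 < m u & 0 < m v]%N)
          (nonedge_mnm G m).
Proof.
apply: (iffP existsP) => [[u /existsP[v /and4P h]]|[u [v h]]].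
  by exists u, v.
by exists u; apply/existsP; exists v; apply/and4P.
Qed.

Lemma nonedge_ideal_mcoeff (k : fieldType) (n : nat) (G : graph n)
    (p : {mpoly k[n]}) :
  nonedge_ideal G p <-> forall m, p@_m != 0 -> nonedge_mnm G m.
Proof.
split=> [[c ->] m|h].
  rewrite raddf_sum => /sum_neq0[u _]; rewrite /= raddf_sum.
  move=> /sum_neq0[v /andP[uv nG]] /mcoeffM_neq0[m1 [m2 [_ nz ->]]].
  apply/nonedge_mnmP; exists u, v; split=> //; rewrite mnmDE addn_gt0.
    by move: nz; rewrite mcoeff_mulX; case: ifP; rewrite ?orbT ?eqxx.
  by move: nz; rewrite mulrC mcoeff_mulX; case: ifP; rewrite ?orbT ?eqxx.
pose P (m : 'X_{1..n}) (z : 'I_n * 'I_n) :=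
  [&& z.1 != z.2, ~~ G z.1 z.2, 0 < m z.1 & 0 < m z.2]%N.
(* Each monomial of [p] is charged to a single non-edge dividing it, so that it is counted once. *)
pose c u v := \sum_(m <- msupp p | [pick z | P m z] == Some (u, v))
  p@_m *: 'X_[m - U_(u) - U_(v)] : {mpoly k[n]}.
exists c; rewrite {1}[p]mpolyE pair_big_dep /=.
under [RHS]eq_bigr => z _ do rewrite /c big_distrl /=.
rewrite (exchange_big_dep predT) //= [LHS]big_seq [RHS]big_seq.
apply: eq_bigr => m; rewrite mcoeff_msupp => /h/nonedge_mnmP[u [v uv]].
case: pickP => [[x y] /and4P[/= xy nG mx my]|/(_ (u, v))/and4P[]]; last by case: uv.
rewrite (big_pred1 (x, y)) /=; last first.
  move=> [x' y']; apply/andP/eqP => [[_ /eqP[-> ->]]|[-> ->]] //=.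
  by rewrite xy nG eqxx.
rewrite -scalerAl -!mpolyXD; congr (_ *: 'X_[_]); apply/mnmP => i.
rewrite !(mnmDE, mnmBE, mnm1E); case: (x =P i) => [<-|]; case: (y =P _) => [e|].
- by rewrite e eqxx in xy.
- by move=> _; lia.
- by rewrite -e => _ /=; lia.
- by move=> _ _ /=; lia.
Qed.

(** A squarefree strand of degree [j] has [j] vertices in its support, and index sets of size [p]
    leave non-cliques of size [j - p], at least 4: the range of [clique_acyc_free]. *)
Lemma nonedge_kos_exact (k : fieldType) (n : nat) (G : graph n) (p j : nat)
    (c : {set 'I_n} -> {mpoly k[n]}) :
  C4_free G -> ~ induced_subgraph F_graph G -> (p + 4 <= j)%N ->
  (forall W m, (c W)@_m != 0 -> #|W| = p /\ (mdeg m + #|W|)%N = j) ->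
  (forall W, nonedge_ideal G (c W)) ->
  (forall W, kos c W = 0) ->
  exists d : {set 'I_n} -> {mpoly k[n]},
    (forall W, nonedge_ideal G (d W)) /\ (forall W, kos d W = c W).
Proof.
move=> C4 hF pj sc Ic cyc.
have [||||d [sd dE]] := @multigraded_exact k n (nonedge_mnm G) (pred1 j) p c; last first.
- by exists d; split=> // W; apply/nonedge_ideal_mcoeff => m /sd[].
(* If [x] has exponent at least 2, it still divides the coefficient after [x] joins the index set,
   so the strand is a cone. *)
- move=> m /eqP mj _; have [/existsP[x mx]|nx] := boolP [exists x, 1 < m x]%N.
    apply: (@acyc_cone _ _ _ _ _ x) => [|A AU]; first by rewrite inE ltnW.
    move=> /nonedge_mnmP[u [v [uv nG mu mv]]].
    have le w : (0 < (m - set_mnm (mnm_set m :\: A))%MM w)%N ->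
        (0 < (m - set_mnm (mnm_set m :\: (A :\ x)))%MM w)%N.
      rewrite !mnmBE !mnmE !inE; have [->|] := eqVneq w x; last by [].
      by move=> _; move: mx; case: (_ && _) => /=; lia.
    by apply/nonedge_mnmP; exists u, v; split=> //; apply: le.
  have mE i : m i = (i \in mnm_set m).
    rewrite inE; move/existsPn: nx => /(_ i); lia.
  have Uj : #|mnm_set m| = j.
    rewrite -mj -mdeg_set_mnm; congr (mdeg _).
    by apply/mnmP => i; rewrite [RHS]mE mnmE.
  rewrite Uj; have -> : (j - p)%N = (j - p - 4).+4 by lia.
  apply: acyc_ext (@clique_acyc_free k n G (mnm_set m) _ C4 hF) => A AU.
  have AE i : (0 < (m - set_mnm (mnm_set m :\: A))%MM i)%N = (i \in A).
    rewrite mnmBE mnmE inE mE; have /implyP := subsetP AU i.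
    by case: (i \in A); case: (i \in _).
  apply/idP/nonedge_mnmP => [/cliquePn[u [v [uA vA uv nG]]]|].
    by exists u, v; rewrite !AE.
  move=> [u [v [uv nG]]]; rewrite !AE => uA vA.
  by apply: contra nG => /cliqueP; apply.
- exact: cyc.
- move=> _; apply/eqP; apply: contraT => /(nonedge_ideal_mcoeff G (c set0)).1.
  by move=> /(_ (Ic _))/nonedge_mnmP[u [v []]]; rewrite mnm0E.
- move=> W m nz; have [h1 h2] := sc W m nz; split=> //; first exact/eqP.
  exact: (nonedge_ideal_mcoeff G (c W)).1 (Ic W) m nz.
Qed.

(** * The double complex of a resolution *)

(** The augmentation counts as the differential leaving position 0, towards the ring with one
    generator of degree 0; this makes the staircase induction uniform. *)
Definition out_rank (k : fieldType) (n : nat) (C : free_complex k n)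
    (q : nat) : nat :=
  if q is q'.+1 then rank C q' else 1.

Definition out (k : fieldType) (n : nat) (C : free_complex k n) (q : nat) :
    'M[{mpoly k[n]}]_(rank C q, out_rank C q) :=
  match q with 0 => aug C | q'.+1 => diff C q' end.

Definition out_shift (k : fieldType) (n : nat) (C : free_complex k n)
    (q : nat) : 'I_(out_rank C q) -> nat :=
  match q with 0 => fun _ => 0%N | q'.+1 => @shift k n C q' end.

Section Resolution.

Variables (k : fieldType) (n : nat) (I : {mpoly k[n]} -> Prop).
Variables (C : free_complex k n) (HC : minimal_graded_free_resolution I C).

Lemma out_exact (q : nat) (v : 'rV_(rank C q)) :
  v *m out C q = 0 <-> exists w, w *m diff C q = v.
Proof. by case: q v => [|q] v; [apply: (aug_exact HC) | apply: (diff_exact HC)]. Qed.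

Lemma out_homog (q : nat) (a : 'I_(rank C q)) (b : 'I_(out_rank C q))
    (m : 'X_{1..n}) :
  (out C q a b)@_m != 0 -> (mdeg m + out_shift b)%N = shift a.
Proof.
case: q a b => [|q] a b /=; rewrite -mcoeff_msupp => nz.
  rewrite addn0; have /dhomogP := aug_homog HC a; apply.
  by rewrite -(ord1 b).
have := diff_homog HC a b; case: leqP => [ba /dhomogP/(_ m nz) mE|_ /eqP d0].
  by rewrite /= in mE; rewrite mE subnK.
by rewrite d0 msupp0 in nz.
Qed.

Lemma mcoeff0_diff (q : nat) (w : 'rV_(rank C q.+1)) (b : 'I_(rank C q)) :
  ((w *m diff C q) 0 b)@_0%MM = 0.
Proof.
rewrite mxE raddf_sum; apply: big1 => a _ /=.
by rewrite rmorphM /= (diff_minimal HC) mulr0.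
Qed.

Lemma lift_rows (c : {set 'I_n} -> {mpoly k[n]}) :
  (forall W, I (c W)) ->
  exists y : {set 'I_n} -> 'rV_(rank C 0), forall W, y W *m aug C = (c W)%:M.
Proof.
move=> Ic; apply: (@fin_all_exists _ _ (fun W y => y *m aug C = (c W)%:M)) => W.
by have [h _] := aug_image HC (c W); exact: h.
Qed.

Definition homog_chain (q p j : nat) (c : {set 'I_n} -> 'rV[{mpoly k[n]}]_(rank C q)) : Prop :=
  forall W b m, (c W 0 b)@_m != 0 ->
    #|W| = p /\ (mdeg m + #|W| + shift b)%N = j.

Lemma homog_out (q p j : nat) (c : {set 'I_n} -> 'rV_(rank C q)) :
  homog_chain p j c ->
  forall W b m, ((c W *m out C q) 0 b)@_m != 0 ->
    #|W| = p /\ (mdeg m + #|W| + out_shift b)%N = j.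
Proof.
move=> hc W b m /mulmx_mcoeff_neq0[a [m1 [m2 [nz1 /out_homog e ->]]]].
have [Wp <-] := hc _ _ _ nz1; split=> //.
by rewrite -e mdegD; lia.
Qed.

(* The staircase chase through the double complex (Koszul complex) (x) C. *)
Lemma double_complex_exact (j e : nat) :
  (forall p (c : {set 'I_n} -> {mpoly k[n]}), (p + e <= j)%N ->
     (forall W m, (c W)@_m != 0 -> #|W| = p /\ (mdeg m + #|W|)%N = j) ->
     (forall W, I (c W)) -> (forall W, kos c W = 0) ->
     exists d : {set 'I_n} -> {mpoly k[n]},
       (forall W, I (d W)) /\ (forall W, kos d W = c W)) ->
  forall q p (c : {set 'I_n} -> 'rV_(rank C q)),
    (p + q + e <= j)%N -> homog_chain p j c ->
    (forall W, kosr (fun W => c W *m out C q) W = 0) ->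
    (p = 0%N -> forall b, ((c set0 *m out C q) 0 b)@_0%MM = 0) ->
    exists (y : {set 'I_n} -> 'rV_(rank C q)) (w : {set 'I_n} -> 'rV_(rank C q.+1)),
      forall W, c W = kosr y W + w W *m diff C q.
Proof.
move=> exI.
(* Agreement after applying [out] suffices: the difference lies in its kernel, hence in the image of
   [diff]. *)
have lift q (c : {set 'I_n} -> 'rV_(rank C q)) :
    (exists y, forall W, kosr y W *m out C q = c W *m out C q) ->
    exists (y : {set 'I_n} -> 'rV_(rank C q)) (w : {set 'I_n} -> 'rV_(rank C q.+1)),
      forall W, c W = kosr y W + w W *m diff C q.
  move=> [y yE].
  have [w wE] : exists w : {set 'I_n} -> 'rV_(rank C q.+1),
      forall W, w W *m diff C q = c W - kosr y W.
    apply: (@fin_all_exists _ _ (fun W v => v *m diff C q = c W - kosr y W)) => W.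
    apply/out_exact.
    by rewrite mulmxBl yE subrr.
  by exists y, w => W; rewrite wE addrC subrK.
elim=> [|q IH] p c pj hc cyc c0; apply: lift.
  pose z W := (c W *m out C 0) 0 0.
  have [|W m /(homog_out hc)[Wp mE]|W|W|d [Id dE]] := exI p z.
  - lia.
  - by split=> //; rewrite -mE addn0.
  - apply/(aug_image HC); exists (c W); apply/rowP => b.
    by rewrite ord1 [RHS]mxE eqxx.
  - by have /rowP/(_ 0) := cyc W; rewrite !mxE.
  have [y yE] := lift_rows Id; exists y => W.
  rewrite -kosr_mulmx; apply/rowP => b; rewrite ord1 mxE -[RHS]dE.
  by apply: eq_kdiff => V; rewrite [out C 0]/= yE mxE eqxx.
(* The image of [c] is a Koszul boundary of some [c'] on sets of size [p.+1]. As [q] drops by one,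
   the bound is unchanged and induction splits [c']; its summand [kosr y] then dies under [kosr]. *)
have [W b m /(homog_out hc)[Wp mE]|||c' [hc' c'E]] :=
    @kosr_exact k n _ p (fun b t => (t + @shift k n C q b == j)%N)
      (fun W => c W *m out C q.+1).
- by split=> //; rewrite -[X in _ == X]mE.
- exact: c0.
- exact: cyc.
have [||W|//|y [w c'D]] := IH p.+1 c'.
- lia.
- by move=> W b m /hc'[h1 /eqP h2].
- rewrite kosr_mulmx c'E; apply/out_exact; by exists (c W).
exists w => W; rewrite -kosr_mulmx -c'E.
rewrite (eq_kosr (d := fun W => kosr y W + w W *m diff C q)) //.
by rewrite kosrD kosr_kosr add0r.
Qed.

End Resolution.

(** * Betti numbers of the non-edge ideal *)

(** A basis vector of larger degree, placed at the empty set, would be a Koszul boundary plus an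
    image under [diff]. Both have zero constant terms, yet its own coordinate is 1. *)
Lemma resolution_shift_le (k : fieldType) (n : nat) (G : graph n)
    (C : free_complex k n) (i : nat) (a : 'I_(rank C i)) :
  minimal_graded_free_resolution (@nonedge_ideal k n G) C ->
  C4_free G -> ~ induced_subgraph F_graph G -> (shift a <= i + 3)%N.
Proof.
move=> HC C4 hF; rewrite leqNgt; apply/negP => ia.
pose c (W : {set 'I_n}) : 'rV[{mpoly k[n]}]_(rank C i) :=
  if W == set0 then delta_mx 0 a else 0.
have c0 W v : c (v |: W) = 0.
  by rewrite /c ifN //; apply/set0Pn; exists v; rewrite setU11.
have [|||||y [w cE]] := @double_complex_exact k n _ C HC (shift a) 4 _ i 0 c.
- by move=> p z pj hz Iz cz; apply: nonedge_kos_exact hz Iz cz.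
- by lia.
- move=> W b m; rewrite /c; case: (W =P set0) => [->|_]; rewrite mxE; last first.
    by rewrite mcoeff0 eqxx.
  rewrite eqxx; case: (b =P a) => [->|_] /=; last by rewrite mcoeff0 eqxx.
  by rewrite mcoeff1; case: (m =P 0%MM) => [->|_]; rewrite ?eqxx // mdeg0 cards0.
- move=> W; apply/rowP => b; rewrite !mxE; apply: big1 => v _.
  by rewrite c0 mul0mx mxE mulr0.
- move=> _ b; rewrite /c eqxx -rowE mxE; apply/eqP; apply: contraT => nz.
  have := out_homog HC nz; clear c c0; case: i a b ia nz => [|i] a b ia nz.
    by rewrite mdeg0 => e; move: ia; rewrite -e.
  by rewrite (diff_minimal HC) eqxx in nz.
have /rowP/(_ a) := cE set0.
rewrite /c eqxx !mxE !eqxx /= => /(congr1 (mcoeff 0%MM)).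
rewrite mcoeffD mcoeff1 eqxx mcoeff0_kos add0r => /esym/eqP.
by have := mcoeff0_diff HC (w set0) a; rewrite mxE => ->; rewrite eq_sym oner_eq0.
Qed.

Lemma mcoeffM_low (k : fieldType) (n : nat) (p q : {mpoly k[n]})
    (m : 'X_{1..n}) :
  p@_0%MM = 0 -> q@_0%MM = 0 -> (mdeg m <= 1)%N -> (p * q)@_m = 0.
Proof.
move=> p0 q0 m1; apply/eqP; apply: contraT => /mcoeffM_neq0[u [v [pu qv mE]]].
have u0 : (0 < mdeg u)%N.
  by rewrite lt0n mdeg_eq0; apply: contraNneq pu => ->; rewrite p0.
have v0 : (0 < mdeg v)%N.
  by rewrite lt0n mdeg_eq0; apply: contraNneq qv => ->; rewrite q0.
by move: m1; rewrite mE mdegD; lia.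
Qed.

Lemma mcoeff0_X (k : fieldType) (n : nat) (v : 'I_n) :
  ('X_v : {mpoly k[n]})@_0%MM = 0.
Proof. by have := @mcoeff_mulX k n v 1 0%MM; rewrite mulr1 mnm0E. Qed.

(* The Koszul syzygy between X_a X_c and X_b X_d is not generated by linear
   syzygies when abcd is an induced 4-cycle. *)
Lemma linear_syzygies_C4_free (k : fieldType) (n : nat) (G : graph n)
    (C : free_complex k n) :
  minimal_graded_free_resolution (@nonedge_ideal k n G) C ->
  (forall a : 'I_(rank C 0), shift a = 2) ->
  (forall a : 'I_(rank C 1), shift a = 3) -> C4_free G.
Proof.
move=> HC sh0 sh1 a b c d ab bc cd da ac bNd; apply: contraT.
rewrite negb_or => /andP[nac nbd].
have neq u v : G u v -> u != v.
  by apply: contraTneq => ->; rewrite adj_irr.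
have nonedgeM u v : u != v -> ~~ G u v ->
    exists y, y *m aug C = ('X_u * 'X_v : {mpoly k[n]})%:M.
  move=> uv nuv; apply/(aug_image HC ('X_u * 'X_v))/nonedge_ideal_mcoeff => m.
  rewrite -mpolyXD mcoeffX; case: (_ =P m) => [<- _|]; last by rewrite eqxx.
  apply/nonedge_mnmP; exists u, v; split=> //; rewrite mnmDE !mnm1E eqxx; lia.
have [P PE] := nonedgeM a c ac nac; have [Q QE] := nonedgeM b d bNd nbd.
pose u := ('X_b * 'X_d) *: P - ('X_a * 'X_c) *: Q.
have [w wE] : exists w, w *m diff C 0 = u.
  apply/(aug_exact HC); rewrite mulmxBl -!scalemxAl PE QE.
  by rewrite -!mul_scalar_mx -!scalar_mxM mulrC subrr.
(* The shifts make [diff C 0] linear, while [u] has no terms of degree 1. So [w0] maps to 0, and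
   [w - w0] is a preimage of [u] without constant terms. *)
pose w0 : 'rV[{mpoly k[n]}]_(rank C 1) := \row_e ((w 0 e)@_0%MM)%:MP.
have w1_0 e : ((w - w0) 0 e)@_0%MM = 0.
  by rewrite !mxE mcoeffB mcoeffC eqxx mulr1 subrr.
have d_homog e f m : (diff C 0 e f)@_m != 0 -> mdeg m = 1%N.
  by move=> /(@out_homog _ _ _ _ HC 1)/=; rewrite sh0 sh1; lia.
have d_0 e f : (diff C 0 e f)@_0%MM = 0 by apply: (diff_minimal HC).
have w0_0 : w0 *m diff C 0 = 0.
  apply/rowP => f; rewrite [RHS]mxE; apply/mpolyP => m; rewrite mcoeff0.
  have [m1|m1] := eqVneq (mdeg m) 1%N; last first.
    rewrite mxE raddf_sum; apply: big1 => e _ /=; rewrite mxE mcoeffCM.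
    apply/eqP; rewrite mulf_eq0; apply/orP; right.
    by apply: contraNT m1 => /d_homog/eqP.
  have : (((w - w0) *m diff C 0) 0 f)@_m = 0.
    rewrite mxE raddf_sum; apply: big1 => e _ /=.
    by apply: mcoeffM_low; rewrite ?m1.
  rewrite mulmxBl wE mxE mcoeffD [X in X + _](_ : _ = 0) ?add0r.
    by rewrite mxE mcoeffN => /eqP; rewrite oppr_eq0 => /eqP.
  have XX0 v v' (r : {mpoly k[n]}) : ('X_v * 'X_v' * r)@_m = 0.
    rewrite -mulrA mcoeffM_low ?m1 ?mcoeff0_X //.
    by rewrite mcoeff_mulX mnm0E.
  by rewrite !mxE mcoeffB !XX0 subr0.
have wE1 : (w - w0) *m diff C 0 = u by rewrite mulmxBl w0_0 subr0.
pose only0 q (x : 'rV[{mpoly k[n]}]_q) (W : {set 'I_n}) :=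
  if W == set0 then x else 0.
have [||W|e [se eE]] := @kosr_exact k n _ 0 (fun _ _ => true) (only0 _ (w - w0)).
- move=> W f m; rewrite /only0; case: (W =P set0) => [->|_]; first by rewrite cards0.
  by rewrite mxE mcoeff0 eqxx.
- by move=> _ f; rewrite /only0 eqxx w1_0.
- apply/rowP => f; rewrite !mxE; apply: big1 => v _; rewrite /only0 ifN.
    by rewrite mxE mulr0.
  by apply/set0Pn; exists v; rewrite setU11.
(* The evident Koszul preimage of [u]. Comparing it with the image of [e] gives a cycle, which
   bounds a chain [t]. *)
pose y (W : {set 'I_n}) := if W == [set b] then 'X_d *: P else
  if W == [set a] then - ('X_c *: Q) else 0.
have ba : b != a by rewrite eq_sym neq.
have set1_inj (v v' : 'I_n) : ([set v] == [set v']) = (v == v').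
  by apply/eqP/eqP => [/set1_inj|->].
have kosy W : kosr y W = only0 _ u W.
  apply/rowP => f; rewrite !mxE /kos /kdiff /only0; case: (W =P set0) => [->|W0].
    rewrite (bigD1 b) ?inE // (bigD1 a) /=; last by rewrite inE eq_sym ba.
    rewrite big1 ?addr0 => [|v /andP[/andP[_ vb] va]].
      rewrite !setU0 /y eqxx set1_inj eq_sym (negPf ba) eqxx.
      have s v : sgn {mpoly k[n]} v set0 = 1.
        rewrite /sgn (_ : [set _ in _ | _] = set0) ?cards0 //.
        by apply/setP => z; rewrite !inE.
      rewrite !s !mxE; ring.
    by rewrite setU0 /y !set1_inj (negPf vb) (negPf va) mxE mulr0.
  rewrite mxE; apply: big1 => v vW.
  have y0 z : (v |: W == [set z]) = false.
    apply/negP => /eqP E; case: W0; apply/setP => x; rewrite inE.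
    apply/negP => xW; have := setU11 v W; have := setU1r v xW.
    rewrite E !inE => /eqP xz /eqP vz.
    by rewrite vz -xz xW in vW.
  by rewrite /y !y0 mxE mulr0.
have [W f m||W|t [_ tE]] := @kosr_exact k n _ 1 (fun _ _ => true)
    (fun W => y W - e W *m diff C 0).
- rewrite mxE mcoeffD; have [y0|] := eqVneq ((y W 0 f)@_m) 0.
    rewrite y0 add0r mxE mcoeffN oppr_eq0 => /mulmx_mcoeff_neq0[x [m1 [m2 [nz _ _]]]].
    by have [-> _] := se _ _ _ nz.
  rewrite /y; case: (W =P [set b]) => [->|_]; first by rewrite cards1.
  case: (W =P [set a]) => [->|_]; first by rewrite cards1.
  by rewrite mxE mcoeff0 eqxx.
- by [].
- rewrite kosrD kosy (eq_kosr (d := fun W => e W *m (- diff C 0))); last first.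
    by move=> V; rewrite mulmxN.
  rewrite kosr_mulmx eE /only0; case: eqP => _; last by rewrite mul0mx addr0.
  by rewrite mulmxN wE1 subrr.
(* The augmentation kills the image of [e], so [g] has values in the ideal and boundary [z]. *)
pose g W := (t W *m aug C) 0 0.
pose z W := (y W *m aug C) 0 0.
have gE W : kos g W = z W.
  have := kosr_mulmx (aug C) t W; rewrite tE mulmxBl.
  have -> : e W *m diff C 0 *m aug C = 0 by apply/(aug_exact HC); exists (e W).
  by rewrite subr0 => E; rewrite /z -E mxE.
have Ig W : nonedge_ideal G (g W).
  apply/(aug_image HC); exists (t W); apply/rowP => f.
  by rewrite ord1 [RHS]mxE eqxx.
pose S := [set a; b; c; d].
pose mu := set_mnm S.
have S_mu : mnm_set mu = S.
  by apply/setP => v; rewrite inE mnmE lt0b.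
have sl W : slice g mu W != 0 -> W \subset S /\
    exists u v, [/\ u != v, ~~ G u v, u \in S :\: W & v \in S :\: W].
  rewrite /slice S_mu; case: ifP => [WS nz|]; last by rewrite eqxx.
  split=> //.
  have /nonedge_mnmP[p [q [pq nG]]] := (nonedge_ideal_mcoeff G (g W)).1 (Ig W) _ nz.
  rewrite !mnmBE !mnmE => hp hq; exists p, q; split=> //; rewrite inE.
    by move: hp; case: (p \in S); case: (p \in W).
  by move: hq; case: (q \in S); case: (q \in W).
have sym p q : G p q -> G q p by rewrite adj_sym.
have nonadj p q : p \in S -> q \in S -> p != q -> ~~ G p q ->
    [set p; q] = [set a; c] \/ [set p; q] = [set b; d].
  have ba' := sym _ _ ab; have cb' := sym _ _ bc.
  have dc' := sym _ _ cd; have ad' := sym _ _ da.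
  rewrite !inE -!orbA => /or4P[]/eqP-> /or4P[]/eqP-> pq npq;
    first [by rewrite eqxx in pq | by left | by right
          | by left; apply: setUC | by right; apply: setUC
          | by case/negP: npq].
have xS x : x \in [set a; c] -> x \in S.
  by rewrite !inE => /orP[] ->; rewrite ?orbT.
(* Another term [v] would need a non-edge of the cycle avoiding [v] and [x]; but one diagonal
   contains [x] and the other contains [v]. *)
have sle x x' : [set x'; x] = [set a; c] -> x' != x ->
   slice z mu [set x] = sgn k x' [set x] * slice g mu [set a; c].
  move=> E xx'; transitivity (slice (kos g) mu [set x]).
    by rewrite /slice gE.
  rewrite slice_kos /kdiff (bigD1 x') /=; last by rewrite inE.
  rewrite mulr1 E big1 ?addr0 // => v; rewrite inE => /andP[vx vx'].
  rewrite mulr1; apply/eqP; rewrite mulf_eq0; apply/orP; right.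
  apply: contraT => /sl[/subsetP vS [p [q [pq nG /setDP[pS pW] /setDP[qS qW]]]]].
  have sub o : o \in v |: [set x] -> o \notin [set p; q].
    by move=> oW; rewrite !inE negb_or; apply/andP; split;
      apply: contraTneq oW => ->.
  have xE : x \in [set a; c] by rewrite -E set22.
  case: (nonadj p q pS qS pq nG) => F.
    by have := sub x; rewrite F xE set22 => /(_ isT).
  have := sub v; rewrite setU11 F => /(_ isT).
  have : v \notin [set a; c] by rewrite -E !inE negb_or vx' vx.
  by have := vS v (setU11 _ _); rewrite !inE; do 4 case: (v == _).
have bc' : b != c := neq _ _ bc.
have dc' : d != c by rewrite eq_sym neq.
have da' : d != a := neq _ _ da.
have ca : c != a by rewrite eq_sym.
(* Up to sign, [z] at [[set c]] and at [[set a]] must both equal [g] at [[set a; c]]; the values 0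
   and -1 contradict this. *)
have Sac : slice z mu [set c] = 0.
  rewrite /slice /z /y !set1_inj (eq_sym c) (negPf bc') (negPf ca) mul0mx mxE.
  by rewrite mcoeff0 if_same.
have Saa : slice z mu [set a] = -1.
  rewrite /slice S_mu sub1set !inE eqxx /= /z /y !set1_inj eq_sym (negPf ba) eqxx.
  rewrite mulNmx -scalemxAl QE !mxE eqxx mulr1n -!mpolyXD mcoeffN mcoeffX.
  rewrite (_ : _ == _) //; apply/eqP/mnmP => i.
  rewrite mnmBE !mnmDE !mnm1E !mnmE !inE ![_ == i]eq_sym.
  have [->|ia] := eqVneq i a; first by rewrite !(eq_sym a) (negPf ba) (negPf ca) (negPf da').
  have [->|ib] := eqVneq i b; first by rewrite (negPf bc') (negPf bNd).
  have [->|ic] := eqVneq i c; first by rewrite (eq_sym c) (negPf dc').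
  by case: (i == d).
have g0 : slice g mu [set a; c] = 0.
  have := sle c a; rewrite Sac => /(_ erefl ac) sE.
  by rewrite -[LHS]mul1r -(sgn_sqr k a [set c]) -mulrA -sE mulr0.
have := sle a c (setUC _ _) ca; rewrite Saa g0 mulr0 => /eqP.
by rewrite oppr_eq0 oner_eq0.
Qed.

Theorem corollary1p7 (k : fieldType) (hk : [pchar k]%R =i pred0)
    (n : nat) (G : graph n)
    (hN : N2 k G 2) (hF : ~ induced_subgraph F_graph G) :
  (reg k G <= 3)%N.
Proof.
(* Both default values of [reg], 1 and 0, satisfy the bound. *)
rewrite /reg; case: ifP => // _.
case: excluded_middle_informative => // ex.
case: constructive_indefinite_description => r /= [[i br] _].
move: hN br; rewrite /N2 /betti /minimal_resolution.
(* Without a resolution all Betti numbers would be 0, against [br]. *)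
case: excluded_middle_informative => // exC.
case: constructive_indefinite_description => C /= HC N br.
have shiftE q (a : 'I_(rank C q)) : (q < 2)%N -> shift a = (q + 2)%N.
  move=> q2; apply: contraPeq (N q (shift a) q2) => /eqP ne /(_ ne) /eqP.
  by rewrite cards_eq0 => /eqP/setP/(_ a); rewrite !inE eqxx.
have C4 : C4_free G.
  by apply: (linear_syzygies_C4_free HC) => a; rewrite shiftE.
have /set0Pn[a] : [set a : 'I_(rank C i) | shift a == (i + r)%N] != set0.
  by rewrite -cards_eq0; apply/eqP.
rewrite inE => /eqP ae.
by have := resolution_shift_le a HC C4 hF; rewrite ae leq_add2l.
Qed.
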